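(* Let $G=(H,+1)$ be a $k$-uniform, $r$-regular oriented hypergraph in which all incidences are labeled $+1$ and in which any two distinct vertices are adjacent exactly $\lambda$ times. Then $$L(G)=\mathrm H(G)\mathrm H(G)^{\mathrm T}=(r-\lambda)I+\lambda J.$$
   Context: A hypergraph $H=(V,E,\mathcal I)$ consists of a finite set $V=\{v_1,\dots,v_n\}$ of vertices, a finite family $E=(e_1,\dots,e_m)$ of subsets of $V$ (the edges; an edge may be empty, and edges with different indices are regarded as different even if they coincide as sets) and its incidences $\mathcal I$. All hypergraphs are simple: each vertex $v\in e$ is incident with $e$ exactly once, so $\mathcal I=\{(v,e): v\in e\}$. $H$ is $k$-uniform if every edge has exactly $k$ elements and $r$-regular if every vertex lies in exactly $r$ edges (i.e. has degree $r$). Two distinct vertices are adjacent exactly $\lambda$ times if exactly $\lambda$ edges contain both. An oriented hypergraph is a pair $G=(H,\sigma)$ with $\sigma:\mathcal I\to\{+1,-1\}$; $G=(H,+1)$ means $\sigma\equiv+1$. The incidence matrix $\mathrm H(G)$ is the $n\times m$ matrix with $(i,j)$-entry $\sigma(v_i,e_j)$ if $(v_i,e_j)\in\mathcal I$ and $0$ otherwise. For an edge $e$ and distinct $v_i,v_j\in e$, put $\mathrm{sgn}_e(v_i,v_j)=-\sigma(v_i,e)\sigma(v_j,e)$. The adjacency matrix $A(G)=(a_{ij})\in\mathbb R^{n\times n}$ has $a_{ij}=\sum_{e}\mathrm{sgn}_e(v_i,v_j)$ for $i\ne j$, the sum being over all edges $e$ containing both $v_i$ and $v_j$ (so $a_{ij}=0$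 if there are none), and $a_{ii}=0$. The Laplacian matrix is $L(G)=D(G)-A(G)$, where $D(G)$ is the diagonal matrix of vertex degrees. $I$ is the $n\times n$ identity matrix and $J$ the $n\times n$ all-ones matrix. *)

(* Defs.v *)
From mathcomp Require Export all_boot all_order all_algebra.
Set Implicit Arguments.
Unset Strict Implicit.
Unset Printing Implicit Defensive.
Import GRing.Theory Num.Theory.
Local Open Scope ring_scope.

(* The vertex set is 'I_n.  Edges are an 'I_m-indexed family, so repeated and
   empty edges are allowed. *)
Record hypergraph (n m : nat) := Hypergraph { edge : 'I_m -> {set 'I_n} }.

Definition incidence n m (H : hypergraph n m) :=
  {p : 'I_n * 'I_m | p.1 \in edge H p.2}.

Definition vdegree n m (H : hypergraph n m) (i : 'I_n) : nat :=
  #|[set e | i \in edge H e]|.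

Definition uniform n m (H : hypergraph n m) (k : nat) : Prop :=
  forall e : 'I_m, #|edge H e| = k.

Definition regular n m (H : hypergraph n m) (r : nat) : Prop :=
  forall i : 'I_n, vdegree H i = r.

Definition adjacent_times n m (H : hypergraph n m) (i j : 'I_n) (l : nat) :
  Prop := #|[set e | (i \in edge H e) && (j \in edge H e)]| = l.

(* Signs are encoded as booleans b standing for (-1) ^+ b, that is, false for
   +1 and true for -1. *)
Record oriented_hypergraph (n m : nat) := OrientedHypergraph {
  underlying : hypergraph n m;
  sigma : incidence underlying -> bool
}.

(* The oriented hypergraph (H, +1). *)
Definition all_positive n m (H : hypergraph n m) : oriented_hypergraph n m :=
  @OrientedHypergraph n m H (fun=> false).

(* sigma(i, e) as a scalar, extended by 0 to the pairs that are not
   incidences. *)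
Definition sigma_val (R : realFieldType) n m (G : oriented_hypergraph n m)
    (i : 'I_n) (e : 'I_m) : R :=
  if insub (i, e) is Some p then (-1) ^+ @sigma n m G p else 0.

Definition incidence_mx (R : realFieldType) n m (G : oriented_hypergraph n m) :
  'M[R]_(n, m) := \matrix_(i, e) sigma_val R G i e.

Definition edge_sgn (R : realFieldType) n m (G : oriented_hypergraph n m)
    (e : 'I_m) (i j : 'I_n) : R :=
  - (sigma_val R G i e * sigma_val R G j e).

Definition adjacency_mx (R : realFieldType) n m (G : oriented_hypergraph n m) :
  'M[R]_n :=
  \matrix_(i, j)
    if i == j then 0
    else \sum_(e | (i \in edge (underlying G) e) &&
                   (j \in edge (underlying G) e)) edge_sgn R G e i j.

Definition degree_mx (R : realFieldType) n m (G : oriented_hypergraph n m) :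
  'M[R]_n := diag_mx (\row_i (vdegree (underlying G) i)%:R).

Definition laplacian_mx (R : realFieldType) n m (G : oriented_hypergraph n m) :
  'M[R]_n := degree_mx R G - adjacency_mx R G.

(* Main.v *)
Require Import Defs.
From mathcomp Require Import all_boot all_order all_algebra.
Import GRing.Theory Num.Theory.
Local Open Scope ring_scope.

(** The [(i, j)] entry of the incidence matrix times its transpose is the sum over edges of the
    products of the signs at [i] and [j]. For [i = j] each sign squares to 1, giving the degree; for
    [i != j] the sum is minus the adjacency entry. Hence [laplacian_mxE] holds for every
    orientation. When all signs are +1, the sum counts the edges containing both vertices
    ([natr_card_sum]): [r] on the diagonal, [lambda] elsewhere. *)

Lemma natr_card_sum (R : realFieldType) (T : finType) (P : pred T) :
  \sum_x (P x)%:R = #|[set x | P x]|%:R :> R.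
Proof.
rewrite -sum1dep_card natr_sum [RHS]big_mkcond.
by apply: eq_bigr => x _; case: (P x).
Qed.

Lemma sigma_val_out (R : realFieldType) n m (G : oriented_hypergraph n m) i e :
  i \notin edge (underlying G) e -> sigma_val R G i e = 0.
Proof. by move=> ie; rewrite /sigma_val insubF //; apply: negbTE. Qed.

(** A sign squares to 1 because the boolean encoding it cancels with itself under [addb]. *)
Lemma sigma_val_sqr (R : realFieldType) n m (G : oriented_hypergraph n m) i e :
  sigma_val R G i e * sigma_val R G i e = (i \in edge (underlying G) e)%:R.
Proof.
have [ie|ie] := boolP (i \in _); last by rewrite sigma_val_out // mul0r.
by rewrite /sigma_val insubT -signr_addb addbb.
Qed.

Lemma sigma_val_all_positive (R : realFieldType) n m (H : hypergraph n m) i e :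
  sigma_val R (all_positive H) i e = (i \in edge H e)%:R.
Proof.
have [ie|ie] := boolP (i \in _); last by rewrite sigma_val_out.
by rewrite /sigma_val insubT.
Qed.

Lemma laplacian_mxE (R : realFieldType) n m (G : oriented_hypergraph n m) :
  laplacian_mx R G = incidence_mx R G *m (incidence_mx R G)^T.
Proof.
apply/matrixP => i j; rewrite !mxE.
under [RHS]eq_bigr => e _ do rewrite !mxE.
have [<-|_] := eqVneq i j.
  under eq_bigr => e _ do rewrite sigma_val_sqr.
  by rewrite natr_card_sum subr0 mulr1n.
(* The minus sign of [laplacian_mx] cancels the one in [edge_sgn]. The product side runs over all
   edges, but any edge missing [i] or [j] contributes a zero factor. *)
rewrite mulr0n sub0r sumrN opprK [RHS](bigID (fun e =>
  (i \in edge (underlying G) e) && (j \in edge (underlying G) e))) /=.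
rewrite [X in _ + X]big1 ?addr0 // => e; rewrite negb_and.
by case/orP => out; rewrite (sigma_val_out _ _ _ _ _ _ out) (mul0r, mulr0).
Qed.

Theorem theorem6p1 (R : realFieldType) (n m k r lambda : nat)
    (H : hypergraph n m) (G : oriented_hypergraph n m)
    (G_pos : G = all_positive H)
    (H_uniform : uniform H k) (H_regular : regular H r)
    (H_adj : forall i j : 'I_n, i != j -> adjacent_times H i j lambda) :
  laplacian_mx R G = incidence_mx R G *m (incidence_mx R G)^T /\
  incidence_mx R G *m (incidence_mx R G)^T =
    (r%:R - lambda%:R) *: 1%:M + lambda%:R *: const_mx 1.
Proof.
split; first exact: laplacian_mxE.
rewrite G_pos; apply/matrixP => i j; rewrite !mxE mulr1.
(* A product of two membership indicators is the indicator of the conjunction, so the sum becomes a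
   count of common edges. *)
under eq_bigr => e _ do
  rewrite !mxE !sigma_val_all_positive -natrM mulnb.
rewrite natr_card_sum.
(* Off the diagonal only [lambda] survives; on it, [r - lambda + lambda] is the degree. *)
have [<-|/H_adj->] := eqVneq i j; last by rewrite mulr0 add0r.
under eq_finset => e do rewrite andbb.
by rewrite mulr1 subrK -(H_regular i).
Qed.
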